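(* Let $0<\varepsilon<1/2$. There is an integer $s<100/\varepsilon$ such that for $\pi(N)(1+o(1))$ primes $p\le N$ (as $N\to\infty$), every integer $\lambda$ can be written as $$F_{n_1}+\cdots+F_{n_s}\equiv\lambda\pmod p,$$ where $1\le n_i\le N^{\varepsilon}$ for $i=1,\ldots,s$.
   Context: $\{F_n\}$ is the Fibonacci sequence: $F_1=F_2=1$, $F_{n+2}=F_{n+1}+F_n$ for $n\ge1$. $\pi(N)$ denotes the number of primes $p\le N$. *)

(* Defs.v *)
From HB Require Import structures.
From mathcomp Require Import all_boot all_order all_algebra.
From mathcomp Require Import all_classical all_reals all_analysis.
Set Implicit Arguments. Unset Strict Implicit. Unset Printing Implicit Defensive.
Import Order.TTheory GRing.Theory Num.Theory.

Fixpoint fib (n : nat) : nat :=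
  match n with
  | 0 => 0
  | 1 => 1
  | (m.+1 as k).+1 => fib k + fib m
  end.

Local Open Scope ring_scope.

Definition good_prime (R : realType) (eps : R) (s N p : nat) : Prop :=
  forall lam : int, exists n : 'I_s -> nat,
    (forall i, (1 <= n i)%N /\ (n i)%:R <= (N%:R : R) `^ eps) /\
    (((\sum_(i < s) fib (n i))%N%:Z = lam %[mod (p%:Z)])%Z).

Definition primepi (N : nat) : nat := (\sum_(p < N.+1 | prime p) 1)%N.

Definition good_count (R : realType) (eps : R) (s N : nat) : nat :=
  (\sum_(p < N.+1 | prime p && `[< good_prime eps s N p >]) 1)%N.

(* Main.v *)
Require Import Defs.
From HB Require Import structures.
From mathcomp Require Import all_boot all_order all_algebra.
From mathcomp Require Import all_classical all_reals all_analysis.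
From mathcomp Require Import zify ring lra.
Import Order.TTheory GRing.Theory Num.Theory numFieldNormedType.Exports.
Local Open Scope ring_scope.

(* Write L_n for the Lucas numbers, M for the integer part of N^(eps/10) and k
   for an integer slightly above 10/eps. For even n <= m one has
   F_m L_n = F_(m+n) + F_(m-n), so if
     A = {F_m : 2M < m <= 2M + M^7},
     B = {sums of k distinct L_(2j), j <= M},
     C = {sums of k distinct F_(2j), j <= M},
   every element of A B + C + C is a sum of 4k Fibonacci numbers with small
   indices. The sequences F_(2j) and L_(2j) are superincreasing, so the sums in B
   and C are distinct integers below 2^(2M+4). A nonzero difference of two of
   them has O(M) prime factors; hence, keeping about N/M^2 sums, all but O(N/M)
   primes p <= N leave at least half of them distinct modulo p, and likewise
   for A. This O(N/M) is o(pi(N)) by Chebyshev's bound. For the remaining primes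
   |A| |B| |C|^2 > p^3, and a second moment argument over all slopes shows
   A B + C + C = F_p. *)

Set Implicit Arguments.
Unset Strict Implicit.

(** * Second moments and sums of products in a finite field *)

Lemma sum_eq_indicator (T : finType) (y : T) : \sum_(x : T) ((y == x)%:R : int) = 1.
Proof.
by rewrite (bigD1 y) //= eqxx big1 ?addr0 // => x; rewrite eq_sym => /negbTE->.
Qed.

(** Distinct lines meet at one abscissa [a] at most, and parallel ones nowhere; only [u = v]
    collides for every [a]. *)
Lemma line_collisions (F : finFieldType) (u v : F * F) :
  \sum_(a : F) ((a * u.1 + u.2 == a * v.1 + v.2)%:R : int)
    <= 1 + (u == v)%:R * #|F|%:R.
Proof.
case: (eqVneq u v) => [->|neq_uv].
  under eq_bigr do rewrite eqxx.
  by rewrite sumr_const mul1r lerDr.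
rewrite mul0r addr0.
have [eq1|neq1] := eqVneq u.1 v.1.
  rewrite big1 // => a _; rewrite eq1 (inj_eq (addrI _)).
  have /negbTE-> // : u.2 != v.2.
  by apply: contraNneq neq_uv; case: u v eq1 => [? ?] [? ?] /= -> ->.
rewrite -[leRHS](sum_eq_indicator ((v.2 - u.2) / (u.1 - v.1))).
apply: ler_sum => a _.
have [eqa|_] := eqVneq (a * u.1 + u.2) (a * v.1 + v.2); last exact: ler0n.
have nz : u.1 - v.1 != 0 by rewrite subr_eq0.
suff -> : (v.2 - u.2) / (u.1 - v.1) = a by rewrite eqxx.
apply: (mulIf nz); rewrite divfK // mulrBr.
by apply/eqP; rewrite subr_eq addrAC eq_sym subr_eq eqa addrC.
Qed.

(* For a uniformly random slope a, the number of representations of x as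
   a * b1 + b2 has variance at most |B1| |B2| / |F| on average over x; a missed
   z would give |A| |C| pairs (a, z - c) at which it is 0 instead of its mean
   |B1| |B2| / |F|. *)
Lemma sum_product_cover (F : finFieldType) (A B1 B2 C : {set F}) :
  (#|F| ^ 3 < #|A| * #|B1| * #|B2| * #|C|)%N ->
  forall z : F, exists a b1 b2 c,
    [/\ a \in A, b1 \in B1, b2 \in B2, c \in C & a * b1 + b2 + c = z].
Proof.
move=> large z.
set U := finset.setX B1 B2.
pose r (a x : F) : int := \sum_(u in U) (a * u.1 + u.2 == x)%:R.
pose n : int := #|U|%:R; pose p : int := #|F|%:R.
have sum_r a : \sum_x r a x = n.
  rewrite exchange_big /= (eq_bigr (fun=> 1)) ?sumr_const // => u _.
  exact: sum_eq_indicator.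
(* Expanding the square counts collisions of pairs [u], [v]; the diagonal supplies the extra
   [p * n]. *)
have sum_r2 : \sum_a \sum_x r a x ^+ 2 <= n ^+ 2 + p * n.
  have -> : \sum_a \sum_x r a x ^+ 2 = \sum_(u in U) \sum_(v in U)
      \sum_a (a * u.1 + u.2 == a * v.1 + v.2)%:R.
    rewrite (eq_bigr (fun a => \sum_(u in U) \sum_(v in U)
        (a * u.1 + u.2 == a * v.1 + v.2)%:R)) => [|a _].
      rewrite exchange_big /=; apply: eq_bigr => u _.
      by rewrite exchange_big.
    rewrite (eq_bigr (fun x => \sum_(u in U) \sum_(v in U)
        (a * u.1 + u.2 == x)%:R * (a * v.1 + v.2 == x)%:R)) => [|x _].
      rewrite exchange_big /=; apply: eq_bigr => u _.
      rewrite exchange_big /=; apply: eq_bigr => v _.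
      rewrite (bigD1 (a * v.1 + v.2)) //= eqxx mulr1 big1 ?addr0 // => x.
      by rewrite eq_sym => /negbTE->; rewrite mulr0.
    rewrite expr2 mulr_suml; apply: eq_bigr => u _.
    by rewrite mulr_sumr.
  apply: (@le_trans _ _ (\sum_(u in U) \sum_(v in U) (1 + (u == v)%:R * p))).
    by apply: ler_sum => u _; apply: ler_sum => v _; exact: line_collisions.
  rewrite (eq_bigr (fun=> n + p)) => [|u uU].
    by rewrite sumr_const -mulr_natr -/n; lia.
  rewrite big_split /= sumr_const -mulr_suml (bigD1 u) //= eqxx big1.
    by rewrite addr0 mul1r.
  by move=> v /andP[_]; rewrite eq_sym => /negbTE->.
(* The mean of [r a] is n / p; scaling the deviation by [p] keeps everything in the integers. *)
have variance : \sum_a \sum_x (p * r a x - n) ^+ 2 <= p ^+ 3 * n.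
  have -> : \sum_a \sum_x (p * r a x - n) ^+ 2 =
      p ^+ 2 * (\sum_a \sum_x r a x ^+ 2) - p ^+ 2 * n ^+ 2.
    rewrite (eq_bigr (fun a => p ^+ 2 * (\sum_x r a x ^+ 2) - p * n ^+ 2)) => [|a _].
      rewrite big_split /= -mulr_sumr sumr_const -[_ *+ _]mulr_natr -/p; ring.
    rewrite (eq_bigr (fun x => p ^+ 2 * r a x ^+ 2 + (- 2 * p * n) * r a x + n ^+ 2)).
      rewrite !big_split /= -!mulr_sumr sum_r sumr_const -[_ *+ _]mulr_natr -/p; ring.
    by move=> x _; ring.
  have := ler_wpM2l (exprn_ge0 2 (ler0n int #|F|)) sum_r2; rewrite -/p; lia.
have nU : n = (#|B1| * #|B2|)%:R by rewrite /n cardsX.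
case: (boolP [exists a in A, exists b1 in B1, exists b2 in B2,
    exists c in C, a * b1 + b2 + c == z]) => [|none].
  case/exists_inP=> a Aa /exists_inP[b1 Bb1] /exists_inP[b2 Bb2] /exists_inP[c Cc].
  by move=> /eqP e; exists a, b1, b2, c.
have r0 a c : a \in A -> c \in C -> r a (z - c) = 0.
  move=> Aa Cc; apply: big1 => -[b1 b2]; rewrite inE /= => /andP[Bb1 Bb2].
  apply/eqP; rewrite pnatr_eq0 eqb0; apply: contra none => /eqP e.
  apply/exists_inP; exists a => //; apply/exists_inP; exists b1 => //.
  apply/exists_inP; exists b2 => //; apply/exists_inP; exists c => //.
  by rewrite e subrK.
have : (#|A| * #|C|)%:R * n ^+ 2 <= p ^+ 3 * n.
  apply: le_trans variance.
  rewrite [leRHS](bigID (mem A)) /=; apply: ler_wpDr.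
    by apply: sumr_ge0 => a _; apply: sumr_ge0 => x _; exact: sqr_ge0.
  apply: (@le_trans _ _ (\sum_(a in A) #|C|%:R * n ^+ 2)).
    by rewrite sumr_const -[leRHS]mulr_natl natrM mulrA.
  apply: ler_sum => a Aa.
  rewrite (reindex_inj (h := fun c => z - c)) /=; last first.
    by move=> x y /addrI/oppr_inj.
  rewrite [leRHS](bigID (mem C)) /=; apply: ler_wpDr.
    by apply: sumr_ge0 => x _; exact: sqr_ge0.
  rewrite (eq_bigr (fun=> n ^+ 2)) => [|c Cc]; last by rewrite r0 // mulr0 sub0r sqrrN.
  by rewrite sumr_const -[leRHS]mulr_natl.
rewrite nU /p -!natrX -!natrM ler_nat => le.
by nia.
Qed.

(** * Primes modulo which many integers collide *)

(** Each distinct prime factor contributes a factor of at least 2 to [n]. *)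
Lemma size_primes_le (n L : nat) : (0 < n)%N -> (n < 2 ^ L)%N -> (size (primes n) <= L)%N.
Proof.
move=> n_gt0 ltn; rewrite -(leq_exp2l (m := 2)) //; apply: leq_trans (ltnW ltn).
rewrite [leqRHS]prod_prime_decomp // prime_decompE big_map /=.
rewrite -sum1_size expn_sum big_seq [leqRHS]big_seq.
apply: leq_prod => p pn; rewrite expn1.
have : prime p by move: pn; rewrite mem_primes => /andP[].
move=> /prime_gt1 p1; apply: (leq_trans p1); rewrite -{1}(expn1 p) leq_exp2l //.
by rewrite logn_gt0.
Qed.

Lemma natr_Fp_eq (p m n : nat) : prime p ->
  ((m%:R : 'F_p) == n%:R) = (m == n %[mod p])%N.
Proof.
by move=> pr_p; rewrite -val_eqE /= !val_Fp_nat.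
Qed.

Lemma card_prime_dvd_le (N n L : nat) : (0 < n)%N -> (n < 2 ^ L)%N ->
  (\sum_(p < N.+1 | prime p) (p %| n) <= L)%N.
Proof.
move=> n_gt0 nL; apply: leq_trans (size_primes_le n_gt0 nL).
rewrite big_mkcond -(big_mkord xpredT (fun p => if prime p then (p %| n : nat) else 0)%N).
rewrite (eq_bigr (fun p => (p \in primes n) : nat)) => [|p _]; last first.
  by rewrite mem_primes n_gt0; case: prime.
rewrite -big_mkcond sum1_count -size_filter.
apply: uniq_leq_size; first by rewrite filter_uniq ?iota_uniq.
by move=> p; rewrite mem_filter => /andP[].
Qed.

(* A fibre of size n contributes n (n - 1) >= 2 n - 2 collisions. *)
Lemma collisions_lower (T U : finType) (I : {set T}) (f : T -> U) :
  (2 * #|I| <= 2 * #|f @: I| + \sum_(x in I) \sum_(y in I | y != x) (f x == f y))%N.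
Proof.
have card_fiber (h : T -> nat) : (\sum_(x in I) h x =
    \sum_(u in f @: I) \sum_(x in I | f x == u) h x)%N.
  by apply: partition_big => x Ix; exact: imset_f.
rewrite mulnC -sum_nat_const card_fiber mulnC -sum_nat_const card_fiber -big_split /=.
apply: leq_sum => u _.
set n := #|[pred x in I | f x == u]|.
rewrite (_ : \sum_(x in I | f x == u) \sum_(y in I | y != x) (f x == f y) =
    \sum_(x in I | f x == u) n.-1)%N; last first.
  apply: eq_bigr => x /andP[Ix /eqP fx].
  have -> : n = #|[predD1 [pred x in I | f x == u] & x]|.+1.
    by rewrite /n (cardD1 x) inE /= Ix fx eqxx.
  rewrite -big_mkcondr sum1_card; apply: eq_card => y; rewrite !inE fx.
  by rewrite unfold_in [u == _]eq_sym -andbA andbCA.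
rewrite !sum_nat_const -/n; nia.
Qed.

(** Double counting of collisions: a bad prime causes at least |I| colliding ordered pairs, while
    each of the at most |I|^2 pairs collides only modulo the prime divisors of its nonzero
    difference, at most [L] in number. *)
Lemma few_bad_primes (T : finType) (I : {set T}) (g : T -> nat) (N L : nat) :
  {in I &, injective g} -> {in I, forall x, (g x < 2 ^ L)%N} ->
  (\sum_(p < N.+1 | prime p && (2 * #|(fun x => (g x)%:R : 'F_p) @: I| < #|I|)) 1
     <= #|I| * L)%N.
Proof.
move=> inj_g lt_g.
have [->|I_gt0] := posnP #|I|; first by rewrite big1 // => p; rewrite ltn0 andbF.
rewrite -(leq_pmul2l I_gt0) big_distrr /= mulnA.
pose coll p := (\sum_(x in I) \sum_(y in I | y != x) ((g x == g y %[mod p])%N : nat))%N.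
apply: (@leq_trans (\sum_(p < N.+1 | prime p) coll p)%N).
  rewrite big_mkcondr /=; apply: leq_sum => p pr_p.
  case: ifP => // few.
  have := collisions_lower I (fun x => (g x)%:R : 'F_p).
  have -> : (\sum_(x in I) \sum_(y in I | y != x)
      ((g x)%:R == (g y)%:R :> 'F_p) = coll p)%N.
    by apply: eq_bigr => x _; apply: eq_bigr => y _; rewrite natr_Fp_eq.
  by move=> /leq_trans/(_ (leq_add (ltnW few) (leqnn _))); rewrite mul2n -addnn muln1 leq_add2l.
rewrite exchange_big /= -mulnA -sum_nat_const; apply: leq_sum => x Ix.
rewrite exchange_big /= -sum_nat_const.
rewrite [leqRHS](bigID (fun y => y != x)) /=.
apply: leq_trans (leq_addr _ _); apply: leq_sum => y /andP[Iy neq_yx].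
wlog lt_xy : x y Ix Iy neq_yx / (g x < g y)%N => [wl|].
  have [|lt|eq] := ltngtP (g x) (g y); first exact: wl.
    by under eq_bigr do rewrite eq_sym; apply: wl => //; rewrite eq_sym.
  by move/eqP: neq_yx; case; apply: inj_g.
under eq_bigr do rewrite eq_sym eqn_mod_dvd ?(ltnW lt_xy) //.
apply: card_prime_dvd_le; first by rewrite subn_gt0.
by apply: leq_ltn_trans (leq_subr _ _) _; exact: lt_g.
Qed.

(** * Chebyshev's lower bound through the central binomial coefficient *)

Lemma leq_two_exp_central_bin (n : nat) : (2 ^ n <= 'C(2 * n, n))%N.
Proof.
elim: n => [|n IHn]; first by rewrite bin0.
rewrite (_ : (2 * n.+1 = (2 * n).+2)%N); last by lia.
rewrite binS expnS mul2n -addnn.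
rewrite -[in X in (_ <= X + _)%N]bin_sub; last by lia.
rewrite (_ : ((2 * n).+1 - n.+1 = n)%N); last by lia.
have : ('C(2 * n, n) <= 'C((2 * n).+1, n))%N.
  by case: (n) => [|m]; rewrite ?bin0 // [leqRHS]binS leq_addr.
lia.
Qed.

(** By Legendre's formula the exponent is the sum over k >= 1 of floor(2n / p^k) - 2 floor(n / p^k).
    Each term is 0 or 1, and it vanishes once p^k > 2n. *)
Lemma expn_logn_central_bin (p n : nat) : prime p -> (0 < n)%N ->
  (p ^ logn p 'C(2 * n, n) <= 2 * n)%N.
Proof.
move=> pr_p n_gt0; have p_gt1 := prime_gt1 pr_p.
have n2_gt0 : (0 < 2 * n)%N by lia.
apply: leq_trans (trunc_logP p_gt1 n2_gt0); rewrite leq_exp2l //.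
have le_n2n : (n <= 2 * n)%N by lia.
have := congr1 (logn p) (bin_fact le_n2n).
rewrite (_ : (2 * n - n = n)%N); last by lia.
rewrite !lognM ?muln_gt0 ?fact_gt0 ?bin_gt0 // !logn_fact //.
set v := logn p _; set t := trunc_log _ _.
have -> : (\sum_(1 <= k < n.+1) n %/ p ^ k = \sum_(1 <= k < (2 * n).+1) n %/ p ^ k)%N.
  rewrite [RHS](big_cat_nat (n := n.+1)) //=.
  rewrite [X in (_ + X)%N]big_nat_cond [X in (_ + X)%N]big1 ?addn0 // => k /andP[/andP[ltk _] _].
  by rewrite divn_small //; apply: leq_trans ltk (ltnW (ltn_expl _ p_gt1)).
have le_t : (t <= 2 * n)%N.
  by apply: leq_trans (ltnW (ltn_expl _ p_gt1)) (trunc_logP _ _).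
suff : (\sum_(1 <= k < (2 * n).+1) (2 * n) %/ p ^ k <=
    \sum_(1 <= k < (2 * n).+1) (2 * (n %/ p ^ k)) + t)%N.
  by rewrite -big_distrr /=; lia.
have -> : (t = \sum_(1 <= k < (2 * n).+1) (k <= t))%N.
  rewrite (big_cat_nat (n := t.+1)) //= big_nat_cond (eq_bigr (fun=> 1%N)); last first.
    by move=> k /andP[/andP[_ +] _]; rewrite ltnS => ->.
  rewrite -big_nat_cond sum_nat_const_nat big_nat_cond big1; first by lia.
  by move=> k /andP[/andP[+ _] _]; rewrite ltnNge => /negbTE->.
rewrite -big_split /=; apply: leq_sum => k _.
have pk_gt0 : (0 < p ^ k)%N by rewrite expn_gt0 prime_gt0.
case: (leqP k t) => [_|lt_tk].
  have := ltn_ceil n pk_gt0; have := leq_trunc_div (2 * n) (p ^ k).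
  set q := (n %/ _)%N; set q' := ((2 * n) %/ _)%N; nia.
rewrite divn_small //; apply: leq_trans (trunc_log_ltn _ p_gt1) _.
by rewrite leq_exp2l.
Qed.

Lemma central_bin_le_primepi (n : nat) : (0 < n)%N ->
  ('C(2 * n, n) <= (2 * n) ^ primepi (2 * n))%N.
Proof.
move=> n_gt0; set b := 'C(_, _).
have b_gt0 : (0 < b)%N by rewrite bin_gt0; lia.
rewrite [leqLHS]prod_prime_decomp // prime_decompE big_map /=.
rewrite /primepi expn_sum.
apply: (@leq_trans (\prod_(p <- primes b) (2 * n))%N).
  rewrite big_seq [leqRHS]big_seq; apply: leq_prod => p; rewrite mem_primes => /andP[pr_p _].
  exact: expn_logn_central_bin.
rewrite big_const_seq count_predT iter_muln_1.
rewrite -expn_sum leq_exp2l; last by lia.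
rewrite -(big_mkord prime (fun=> 1%N)) sum1_count -size_filter.
apply: uniq_leq_size; first exact: primes_uniq.
move=> p; rewrite mem_primes => /and3P[pr_p _ dvd_p].
rewrite mem_filter pr_p mem_index_iota /= ltnS.
have : (p %| (2 * n)`!)%N.
  by rewrite -(@bin_fact (2 * n) n) ?dvdn_mulr //; lia.
elim: (2 * n)%N => [|m IHm]; first by rewrite fact0 dvdn1; case: eqP pr_p => // ->.
by rewrite factS Euclid_dvdM // => /orP[/dvdn_leq -> //|/IHm /leqW].
Qed.

(* Chebyshev's lower bound, in the form [N <= 2 log2(N) pi(N) + 1] *)
Lemma chebyshev_lower (N t : nat) : (N < 2 ^ t)%N -> (N <= 2 * t * primepi N + 1)%N.
Proof.
move=> ltN; have [N1|N2] := leqP N 1; first by lia.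
have n_gt0 : (0 < N./2)%N by lia.
have le_half : (2 * N./2 <= N)%N by lia.
have le_pi : (primepi (2 * N./2) <= primepi N)%N.
  rewrite /primepi -!(big_mkord prime (fun=> 1%N)).
  by rewrite [leqRHS](big_cat_nat (n := (2 * N./2).+1)) ?leq_addr //; lia.
have : (2 ^ N./2 <= 2 ^ (t * primepi N))%N.
  apply: leq_trans (leq_two_exp_central_bin _) _.
  apply: leq_trans (central_bin_le_primepi n_gt0) _.
  rewrite expnM; apply: leq_trans (leq_pexp2l _ le_pi) _; first by lia.
  by case: (primepi N) => [|m] //; rewrite leq_exp2r //; lia.
by rewrite leq_exp2l //; lia.
Qed.

(** * Subset sums of superincreasing sequences *)

(** At the largest index [j] where two subsets differ, the term [g j] outweighs all lower terms
    together. *)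
Lemma subset_sums_inj (g : nat -> nat) (n : nat) :
  (forall j, \sum_(i < j) g i < g j)%N ->
  injective (fun S : {set 'I_n} => \sum_(i in S) g i)%N.
Proof.
move=> superinc S S' eq_sum; apply/eqP; apply: contraT => neq.
pose D := [set i : 'I_n | (i \in S) != (i \in S')].
have [i0 Di0] : exists i, i \in D.
  apply/existsP; apply: contraNT neq => /existsPn D0; apply/eqP/setP => i.
  by have := D0 i; rewrite inE negbK => /eqP.
have {i0 Di0} [j Dj j_max] : exists2 j : 'I_n, (j \in S) != (j \in S') &
    forall i : 'I_n, (i \in S) != (i \in S') -> (i <= j)%N.
  case: (@arg_maxnP _ i0 (mem D) (fun i => i : nat) Di0) => j Dj j_max.
  exists j => [|i Di]; first by move: Dj; rewrite /= inE.
  by apply: j_max; rewrite /= inE.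
move: {D} neq => _.
wlog jS : S S' eq_sum Dj j_max / j \in S => [wl|].
  have [jS|jS] := boolP (j \in S); first exact: (wl S S').
  apply: (wl S' S) => // [|i|]; rewrite 1?eq_sym //; first exact: j_max.
  by move: Dj; rewrite (negbTE jS); case: (j \in S').
have jS' : j \notin S' by move: Dj; rewrite jS.
have eq_above (i : 'I_n) : (j < i)%N -> (i \in S) = (i \in S').
  move=> ltji; apply/eqP; apply: contraLR ltji => neq_i.
  by rewrite -leqNgt; exact: j_max.
have le_below : (\sum_(i in S' | ~~ (j < i)) g i < g j)%N.
  apply: leq_ltn_trans (superinc j).
  have jn := ltn_ord j.
  rewrite (big_ord_widen_cond n xpredT g (ltnW jn)) [leqLHS]big_mkcond [leqRHS]big_mkcond /=.
  apply: leq_sum => i _; rewrite -leqNgt [(i <= j)%N]leq_eqVlt.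
  have [/val_inj->|_] /= := eqVneq (i : nat) j; first by rewrite (negbTE jS').
  by case: (i \in S'); case: (i < j)%N.
move: eq_sum; rewrite (bigID (fun i : 'I_n => j < i)%N) [RHS](bigID (fun i : 'I_n => j < i)%N) /=.
rewrite (eq_bigl (fun i => (i \in S') && (j < i))%N) => [|i]; last first.
  by case: (boolP (j < i)%N) => [/eq_above->//|]; rewrite !andbF.
move/addnI; rewrite (bigD1 j) /=; last by rewrite jS ltnn.
by move=> eq; move: le_below; rewrite -eq ltnNge leq_addr.
Qed.

Lemma subset_sums_lt (g : nat -> nat) (n : nat) (S : {set 'I_n}) :
  (forall j, \sum_(i < j) g i < g j)%N -> (\sum_(i in S) g i < g n)%N.
Proof.
move=> /(_ n); apply: leq_ltn_trans.
by rewrite [leqRHS](bigID (mem S)) leq_addr.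
Qed.

(** * Fibonacci and Lucas numbers *)

Lemma fibSS (n : nat) : fib n.+2 = (fib n.+1 + fib n)%N.
Proof. by []. Qed.

Lemma fib_gt0 (n : nat) : (0 < fib n.+1)%N.
Proof. by elim: n => // n IHn; rewrite fibSS; lia. Qed.

Lemma fib_lt_exp2 (n : nat) : (fib n < 2 ^ n)%N.
Proof.
suff : (fib n < 2 ^ n)%N && (fib n.+1 < 2 ^ n.+1)%N by case/andP.
elim: n => // n /andP[lt1 lt2]; rewrite lt2 fibSS.
by rewrite [(2 ^ n.+2)%N]expnS; move: lt1 lt2; rewrite expnS; lia.
Qed.

Lemma fib_add (m n : nat) : fib (m + n).+1 = (fib m.+1 * fib n.+1 + fib m * fib n)%N.
Proof.
elim: m n => [|m IHm] n; first by rewrite mul1n mul0n addn0.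
by rewrite addSnnS IHm !fibSS mulnDl mulnDr; lia.
Qed.

(* [luc n] is the Lucas number [L_{n+1}] *)
Definition luc (n : nat) : nat := (fib n + fib n.+2)%N.

(** Cassini's identity; restricting to even index fixes its alternating sign, so that it can be
    stated in [nat]. *)
Lemma cassini_even (j : nat) :
  (fib (2 * j).+1 ^ 2 = fib (2 * j) * fib (2 * j).+1 + fib (2 * j) ^ 2 + 1)%N.
Proof.
elim: j => // j IHj.
rewrite (_ : (2 * j.+1 = (2 * j).+2)%N); last by lia.
rewrite !fibSS; move: IHj; move: (fib (2 * j).+1) (fib (2 * j)) => x y; nia.
Qed.

(** Both sides satisfy the Fibonacci recurrence in [m], so m = 0 and m = 1 suffice; there the
    addition formula and Cassini apply. Writing the larger index as m + n, with n = 2j + 2, avoids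
    the subtraction in F_(m-n). *)
Lemma fib_mul_luc (m j : nat) :
  (fib (m + 2 * j.+1) * luc (2 * j).+1 = fib (m + 4 * j.+1) + fib m)%N.
Proof.
rewrite /luc; have -> : (2 * j.+1 = (2 * j).+2)%N by lia.
have -> : (4 * j.+1 = ((2 * j).+1 + (2 * j).+2).+1)%N by lia.
have := cassini_even j.
elim/ltn_ind: m => -[|[|m]] IH cas.
- rewrite [fib 0]/= !add0n fib_add !fibSS; move: cas.
  by move: (fib (2 * j).+1) (fib (2 * j)) => x y; nia.
- rewrite [fib 1]/= !add1n -addSn fib_add !fibSS; move: cas.
  by move: (fib (2 * j).+1) (fib (2 * j)) => x y; nia.
have h0 := IH m (leqnSn m.+1) cas; have h1 := IH m.+1 (leqnn _) cas.
move: h0 h1; set L := (fib _.+1 + _)%N; set a := (2 * j).+2; set b := (_ + _).+1.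
by rewrite !addSn !fibSS mulnDl => -> ->; lia.
Qed.

Lemma sum_fib_even (j : nat) : (\sum_(i < j) fib (2 * i).+2 + 1 = fib (2 * j).+1)%N.
Proof.
elim: j => [|j IHj]; first by rewrite big_ord0.
rewrite big_ord_recr addnAC IHj (_ : (2 * j.+1 = (2 * j).+2)%N); last by lia.
by rewrite [RHS]fibSS addnC.
Qed.

Lemma fib_even_superincreasing (j : nat) :
  (\sum_(i < j) fib (2 * i).+2 < fib (2 * j).+2)%N.
Proof. by rewrite fibSS -sum_fib_even; lia. Qed.

Lemma sum_luc_even (j : nat) : (\sum_(i < j) luc (2 * i).+1 + 1 = luc (2 * j))%N.
Proof.
elim: j => [|j IHj]; first by rewrite big_ord0.
rewrite big_ord_recr addnAC IHj [nat_of_ord _]/= /luc (_ : (2 * j.+1 = (2 * j).+2)%N); last by lia.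
by rewrite [fib (2 * j).+4]fibSS [fib (2 * j).+2]fibSS; lia.
Qed.

Lemma luc_even_superincreasing (j : nat) :
  (\sum_(i < j) luc (2 * i).+1 < luc (2 * j).+1)%N.
Proof.
have le_fib : (fib (2 * j) <= fib (2 * j).+1)%N.
  by case: (2 * j)%N => // n; rewrite fibSS leq_addr.
have := sum_luc_even j; rewrite /luc [fib (2 * j).+3]fibSS [fib (2 * j).+2]fibSS; lia.
Qed.

(** Strict growth starts at index 2, because F_1 = F_2. *)
Lemma fib_inj (m n : nat) : (1 < m)%N -> (1 < n)%N -> fib m = fib n -> m = n.
Proof.
have step i : (1 < i)%N -> (fib i < fib i.+1)%N.
  by case: i => [|[|i]] // _; rewrite [ltnRHS]fibSS; have := fib_gt0 i; lia.
have mono i j : (1 < i)%N -> (i < j)%N -> (fib i < fib j)%N.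
  move=> i1; elim: j => // j IHj; rewrite ltnS leq_eqVlt => /orP[/eqP <-|ltij].
    exact: step.
  by apply: ltn_trans (IHj ltij) (step _ _); exact: ltn_trans ltij.
move=> m1 n1 eq; case: (ltngtP m n) => // lt; first by move: (mono _ _ m1 lt); rewrite eq ltnn.
by move: (mono _ _ n1 lt); rewrite eq ltnn.
Qed.

(** * Representing all residues by Fibonacci sums *)

Local Arguments fib : simpl never.

(** A version of [good_prime] with an integer bound on the indices, which keeps real powers out of
    the counting. *)
Definition fib_covers (s b p : nat) : Prop :=
  forall lam : int, exists n : 'I_s -> nat,
    (forall i, 1 <= n i <= b)%N /\
    (((\sum_(i < s) fib (n i))%N%:Z = lam %[mod (p%:Z)])%Z).

Lemma fib_covers_seq (s b p : nat) : prime p ->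
  (forall z : 'F_p, exists l : seq nat,
     [/\ size l = s, all (fun n => 1 <= n <= b)%N l & (\sum_(n <- l) fib n)%:R = z]) ->
  fib_covers s b p.
Proof.
move=> pr_p cover lam.
have p_gt0 : (0 < p)%N by exact: prime_gt0.
have lam_ge0 : (0 <= lam %% p)%Z by rewrite modz_ge0; lia.
have [l [size_l bound_l sum_l]] := cover `|(lam %% p)%Z|%N%:R.
exists (fun i => nth 0%N l i); split => [i|].
  by apply: (allP bound_l); rewrite mem_nth // size_l.
have -> : (\sum_(i < s) fib (nth 0%N l i) = \sum_(n <- l) fib n)%N.
  by rewrite -size_l [RHS](big_nth 0%N) big_mkord.
move/eqP: sum_l; rewrite natr_Fp_eq // => /eqP eq_mod.
by rewrite modz_nat eq_mod -modz_nat gez0_abs // modz_mod.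
Qed.

(** With j = i + 1 ranging over 1, ..., M, the terms here are F_(2j), and those of [lucsum] are
    L_(2j). *)
Definition fibsum (M : nat) (S : {set 'I_M}) : nat := (\sum_(i in S) fib (2 * i).+2)%N.
Definition lucsum (M : nat) (S : {set 'I_M}) : nat := (\sum_(i in S) luc (2 * i).+1)%N.

Lemma fib_covers_of_large (M k H p : nat) (K : {set {set 'I_M}}) : prime p ->
  {in K, forall S : {set 'I_M}, #|S| = k} ->
  let A := (fun i : 'I_H => (fib (2 * M + i).+1)%:R : 'F_p) @: [set: 'I_H] in
  let B := (fun S => (lucsum S)%:R : 'F_p) @: K in
  let C := (fun S => (fibsum S)%:R : 'F_p) @: K in
  (p ^ 3 < #|A| * #|B| * #|C| * #|C|)%N ->
  fib_covers (4 * k) (4 * M + H) p.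
Proof.
move=> pr_p cardK A B C large; apply: fib_covers_seq => // z.
have := @sum_product_cover 'F_p A B C C; rewrite card_Fp // => /(_ large z).
case=> _ [_ [_ [_ [/imsetP[i _ ->] /imsetP[S SK ->] /imsetP[S1 S1K ->]
  /imsetP[S2 S2K ->] eq_z]]]].
have lt_i := ltn_ord i.
(* The first two lists hold the indices m + n and m - n from expanding F_m times a Lucas sum. As m >
   2M >= n, the difference stays positive. *)
exists ([seq (2 * M + i).+1 + 2 * j.+1 | j : 'I_M in S] ++
        [seq (2 * M + i).+1 - 2 * j.+1 | j : 'I_M in S] ++
        [seq (2 * j).+2 | j : 'I_M in S1] ++ [seq (2 * j).+2 | j : 'I_M in S2])%N.
split; first by rewrite !size_cat !size_image !cardK //; lia.
  rewrite !all_cat; apply/and4P; split; apply/allP => x /mapP[j _ ->];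
  by have := ltn_ord j; lia.
rewrite !big_cat /= !big_image /= -eq_z /fibsum /lucsum -natrM -!natrD.
rewrite addnA -big_split /= big_distrr /= addnA.
congr (_ + _ + _)%:R; apply: eq_bigr => j _.
have [m ->] : exists m, (2 * M + i).+1 = (m + 2 * j.+1)%N.
  by exists ((2 * M + i).+1 - 2 * j.+1)%N; have := ltn_ord j; lia.
rewrite fib_mul_luc; congr (fib _ + fib _)%N; lia.
Qed.

(** * Choice of parameters and the count of exceptional primes *)

(** Every factor M - i of the falling factorial is at least M / 2. *)
Lemma bin_lower (M k : nat) : (2 * k <= M)%N -> (M ^ k <= 2 ^ k * k`! * 'C(M, k))%N.
Proof.
move=> le_kM; rewrite -mulnA [(k`! * _)%N]mulnC bin_ffact ffact_prod.
have <- : (\prod_(i < k) M = M ^ k)%N by rewrite prod_nat_const card_ord.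
have <- : (\prod_(i < k) 2 = 2 ^ k)%N by rewrite prod_nat_const card_ord.
by rewrite -big_split /=; apply: leq_prod => i _; have := ltn_ord i; lia.
Qed.

Lemma subset_of_card (T : finType) (A : {set T}) (n : nat) : (n <= #|A|)%N ->
  exists2 B : {set T}, B \subset A & #|B| = n.
Proof.
move=> le_n; exists [set x in take n (enum A)].
  by apply/fintype.subsetP => x; rewrite inE => /mem_take; rewrite mem_enum.
rewrite cardsE; apply/eqP; rewrite -[eqbRHS](@size_takel n _ (enum A)) -?cardE //.
by apply/eqP/card_uniqP; rewrite take_uniq ?enum_uniq.
Qed.

(* The parameters: A has M^7 elements and each of B, C about N / M^2, half of
   which survive modulo p, so that |A| |B| |C|^2 exceeds N^3. *)
Lemma few_uncovered_primes (M k N : nat) :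
  (129 <= M)%N -> (2 * k <= M)%N -> (4 ^ k * k`! <= M)%N ->
  (M ^ 20 <= N)%N -> (N < M.+1 ^ k)%N ->
  (M * \sum_(p < N.+1 | prime p && ~~ `[< fib_covers (4 * k) (M ^ 10) p >]) 1
     <= 7 * N)%N.
Proof.
move=> M129 le_kM le_fact leN ltN.
set Q := (N %/ M ^ 2)%N.
have M_gt0 : (0 < M)%N by lia.
have M2_gt0 : (0 < M ^ 2)%N by rewrite expn_gt0 M_gt0.
(* N < (M + 1)^k <= (2M)^k <= 4^k k! C(M, k) <= M^2 C(M, k). *)
have leQ : (Q <= #|[set S : {set 'I_M} | #|S| == k]|)%N.
  rewrite card_draws card_ord -(leq_pmul2r M2_gt0).
  apply: leq_trans (leq_trunc_div _ _) _; apply: leq_trans (ltnW ltN) _.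
  apply: (@leq_trans ((2 * M) ^ k)%N); first by case: (k) => // k'; rewrite leq_exp2r; lia.
  rewrite expnMn; apply: leq_trans (leq_mul (leqnn _) (bin_lower le_kM)) _.
  rewrite [leqRHS]mulnC !mulnA -expnMn leq_mul //; apply: leq_trans le_fact _.
  by rewrite -{1}(expn1 M) leq_exp2l; lia.
have [K subK cardK] := subset_of_card leQ.
have cardKk : {in K, forall S : {set 'I_M}, #|S| = k}.
  by move=> S /(fintype.subsetP subK); rewrite inE => /eqP.
pose A p := (fun i : 'I_(M ^ 7) => (fib (2 * M + i).+1)%:R : 'F_p) @: [set: 'I_(M ^ 7)].
pose B p := (fun S => (lucsum S)%:R : 'F_p) @: K.
pose C p := (fun S => (fibsum S)%:R : 'F_p) @: K.
have badA := @few_bad_primes _ [set: 'I_(M ^ 7)] (fun i => fib (2 * M + i).+1) N (2 * M + M ^ 7).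
have badB := @few_bad_primes _ K (@lucsum M) N (2 * M + 4).
have badC := @few_bad_primes _ K (@fibsum M) N (2 * M + 4).
have pw (a b : nat) : (a <= b)%N -> (2 ^ a <= 2 ^ b)%N by move=> ?; rewrite leq_exp2l.
have {}badA : (\sum_(p < N.+1 | prime p && (2 * #|A p| < M ^ 7)) 1 <= M ^ 7 * (2 * M + M ^ 7))%N.
  rewrite cardsT card_ord in badA; apply: badA => [i j _ _ eq_fib|i _].
    have gt1 l : (1 < (2 * M + l).+1)%N by rewrite ltnS addn_gt0 muln_gt0 M_gt0.
    by apply/val_inj/(@addnI (2 * M))/succn_inj/fib_inj.
  by apply: leq_trans (fib_lt_exp2 _) (pw _ _ _); have := ltn_ord i; lia.
have {}badB : (\sum_(p < N.+1 | prime p && (2 * #|B p| < Q)) 1 <= Q * (2 * M + 4))%N.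
  rewrite cardK in badB; apply: badB => [S S' _ _|S _].
    exact: (@subset_sums_inj (fun i => luc (2 * i).+1) M luc_even_superincreasing).
  apply: leq_trans (@subset_sums_lt (fun i => luc (2 * i).+1) M S luc_even_superincreasing) _.
  have lt1 : (fib (2 * M).+1 < 2 ^ (2 * M).+3)%N.
    by apply: leq_trans (fib_lt_exp2 _) (pw _ _ _); exact: leqW (leqnSn _).
  rewrite /luc addn4 [leqRHS]expnS [leqRHS]mul2n -[leqRHS]addnn.
  by rewrite leq_add ?(ltnW lt1) // ltnW // fib_lt_exp2.
have {}badC : (\sum_(p < N.+1 | prime p && (2 * #|C p| < Q)) 1 <= Q * (2 * M + 4))%N.
  rewrite cardK in badC; apply: badC => [S S' _ _|S _].
    exact: (@subset_sums_inj (fun i => fib (2 * i).+2) M fib_even_superincreasing).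
  apply: leq_trans (@subset_sums_lt (fun i => fib (2 * i).+2) M S fib_even_superincreasing) _.
  by apply: leq_trans (ltnW (fib_lt_exp2 _)) (pw _ _ _); lia.
have bound : (\sum_(p < N.+1 | prime p && ~~ `[< fib_covers (4 * k) (M ^ 10) p >]) 1 <=
    M ^ 7 * (2 * M + M ^ 7) + Q * (2 * M + 4) + Q * (2 * M + 4))%N.
  apply: leq_trans (leq_add (leq_add badA badB) badC).
  rewrite !big_mkcondr -!big_split /=; apply: leq_sum => p pr_p.
  case: ifP => // /asboolPn not_cov.
  case: (ltnP _ (M ^ 7)%N) => // largeA; case: (ltnP _ Q) => // largeB.
  case: (ltnP _ Q) => // largeC; case: not_cov.
  have le_b : (4 * M + M ^ 7 <= M ^ 10)%N.
    clear -M129.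
    rewrite (_ : 10 = 7 + 3)%N // expnD.
    have : (M ^ 1 <= M ^ 7)%N by rewrite leq_exp2l; lia.
    by have : (M ^ 1 <= M ^ 3)%N by [rewrite leq_exp2l; lia]; rewrite expn1; nia.
  have : fib_covers (4 * k) (4 * M + M ^ 7) p.
    apply: (fib_covers_of_large pr_p cardKk); rewrite -/(A p) -/(B p) -/(C p).
    have lep : (p <= N)%N by rewrite -ltnS.
    have ltQ := ltn_ceil N M2_gt0; rewrite -/Q in ltQ.
    have N_large : (2 * M ^ 2 <= N)%N.
      apply: leq_trans leN; rewrite (_ : 20 = 18 + 2)%N // expnD leq_mul2r; apply/orP; right.
      by apply: (@leq_trans (M ^ 1)%N); [lia | rewrite leq_exp2l; lia].
    (* Rounding down in [Q] costs at most a factor 2. *)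
    have leNQ : (N <= 2 * (M ^ 2 * Q))%N by move: (M ^ 2)%N N_large ltQ; clear; lia.
    have leN3 : (N ^ 3 <= 8 * (M ^ 6 * Q ^ 3))%N.
      by move: leNQ; rewrite -(leq_exp2r _ _ (e := 3)) // (expnMn 2) (expnMn (M ^ 2)) -expnM.
    have le16 : (M ^ 7 * (Q * Q * Q) <= 2 * #|A p| * (2 * #|B p| * (2 * #|C p|) * (2 * #|C p|)))%N.
      by do 2![apply: leq_mul => //]; exact: leq_mul.
    (* Halving four sets costs 16 and rounding [Q] three times costs 8, so |A| |B| |C|^2 >= M N^3 /
       128; hence the threshold 129. *)
    have leM : (129 * N ^ 3 <= M * N ^ 3)%N by rewrite leq_mul2r M129 orbT.
    have lep3 : (p ^ 3 <= N ^ 3)%N by rewrite leq_exp2r.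
    have N3_gt0 : (0 < N ^ 3)%N by rewrite expn_gt0; lia.
    have le8 : (M * N ^ 3 <= 8 * (M ^ 7 * (Q * Q * Q)))%N.
      apply: leq_trans (leq_mul (leqnn M) leN3) _.
      by rewrite mulnCA (mulnA M) -expnS (expnSr Q 2) -mulnn.
    move: le16 le8 leM lep3 N3_gt0.
    move: #|A p| #|B p| #|C p| (M ^ 7 * _)%N (N ^ 3)%N (p ^ 3)%N => a b c x y w; clear; lia.
  by move=> cov lam; have [n [bn eqn]] := cov lam; exists n; split=> // i; have /andP[-> /leq_trans->] := bn i.
apply: leq_trans (leq_mul (leqnn M) bound) _.
have leQN : (Q * M ^ 2 <= N)%N by exact: leq_trunc_div.
(* After multiplication by [M], the primes bad for A cost at most N and those for B and C at most 3N
   each: 7N in all. *)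
have le16 : (M * (M ^ 7 * (2 * M + M ^ 7)) <= N)%N.
  apply: leq_trans leN; rewrite (_ : 20 = 1 + 7 + 12)%N // !expnD expn1 mulnA leq_mul2l.
  apply/orP; right; rewrite (_ : 12 = 7 + 5)%N // expnD.
  have : (M ^ 1 <= M ^ 7)%N by rewrite leq_exp2l; lia.
  have : (M ^ 1 <= M ^ 5)%N by rewrite leq_exp2l; lia.
  by rewrite expn1; move: (M ^ 7)%N (M ^ 5)%N M129; clear; nia.
have leQ6 : (M * (Q * (2 * M + 4)) <= 3 * N)%N.
  by apply: (@leq_trans (3 * (Q * M ^ 2))%N); [rewrite -mulnn; move: M129; clear; nia | lia].
by move: le16 leQ6; clear; lia.
Qed.

(** As N is below a fixed power of M + 1, log N is O(log M), which [M] outgrows by any constant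
    factor. *)
Lemma primepi_lower (D k : nat) : exists M0 : nat, forall M N : nat,
  (M0 <= M)%N -> (1 < N)%N -> (N < M.+1 ^ k)%N -> (D * N <= M * primepi N)%N.
Proof.
(* This threshold forces a >= c + 4, whence c (a + 1) <= (a - 4)(a + 1) < a^2 <= 2^a <= M + 1. *)
set c := (4 * D * k)%N; exists (2 ^ (c + 4))%N => M N leM N1 ltN.
set a := trunc_log 2 M.+1.
have le_ca : (c + 4 <= a)%N by apply: trunc_log_max => //; exact: leqW.
have sqr_exp b : (b.+4 ^ 2 <= 2 ^ b.+4)%N.
  elim: b => // b IHb; rewrite [leqRHS]expnS.
  by apply: leq_trans (leq_mul (leqnn 2) IHb); rewrite -!mulnn; nia.
have leaM : (c * a.+1 <= M)%N.
  have : (2 ^ a <= M.+1)%N by exact: trunc_logP.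
  have := sqr_exp (a - 4)%N; rewrite (_ : (a - 4).+4 = a); last by lia.
  by move: le_ca; rewrite -mulnn; move: (2 ^ a)%N; clear; nia.
have : (N < 2 ^ (a.+1 * k))%N.
  apply: leq_trans ltN _; rewrite expnM; case: (k) => // k'.
  by rewrite leq_exp2r //; apply: ltnW; exact: trunc_log_ltn.
move=> /chebyshev_lower; move: leaM; rewrite /c; move: (primepi N) => P leaM leN.
have {leN} : (N <= 4 * (a.+1 * k) * P)%N by lia.
move=> /(leq_mul (leqnn D))/leq_trans; apply.
by apply: leq_trans (leq_mul leaM (leqnn P)); lia.
Qed.

(** At most 7N / M primes are uncovered, against pi(N) >= 7DN / M; letting [D] be arbitrary makes
    this o(pi(N)). *)
Lemma few_uncovered_primes_asymptotic (D k : nat) : exists M0 : nat, forall M N : nat,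
  (M0 <= M)%N -> (M ^ 20 <= N)%N -> (N < M.+1 ^ k)%N ->
  (D * \sum_(p < N.+1 | prime p && ~~ `[< fib_covers (4 * k) (M ^ 10) p >]) 1
     <= primepi N)%N.
Proof.
have [M0 pi_large] := primepi_lower (7 * D) k.
exists (M0 + 129 + 2 * k + 4 ^ k * k`!)%N => M N leM leN ltN.
have [leM0 M129 le_kM le_fact] : [/\ M0 <= M, 129 <= M, 2 * k <= M & 4 ^ k * k`! <= M]%N.
  by move: leM; move: (4 ^ k * k`!)%N; clear; split; lia.
have M_gt1 : (1 < M)%N by move: M129; clear; lia.
have N_gt1 : (1 < N)%N.
  apply: leq_trans leN; apply: (@leq_trans (M ^ 1)%N); first by rewrite expn1.
  by rewrite leq_exp2l.
have := few_uncovered_primes M129 le_kM le_fact leN ltN.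
set bad := (\sum_(_ < _ | _) _)%N => le_bad.
rewrite -(leq_pmul2l (ltnW M_gt1)); apply: leq_trans (pi_large _ _ leM0 N_gt1 ltN).
by rewrite mulnCA [(7 * D)%N]mulnC -mulnA leq_mul.
Qed.

(** * Return to real exponents and passage to the limit *)

Lemma good_prime_of_covers (R : realType) (eps : R) (s N b p : nat) :
  (b%:R : R) <= N%:R `^ eps -> fib_covers s b p -> good_prime eps s N p.
Proof.
move=> le_b cov lam; have [n [bn eqn]] := cov lam; exists n; split=> // i.
have /andP[n_ge1 n_le] := bn i; split=> //; apply: le_trans le_b.
by rewrite ler_nat.
Qed.

Lemma primepi_le_good (R : realType) (eps : R) (s N b : nat) :
  (b%:R : R) <= N%:R `^ eps ->
  (primepi N <= good_count eps s N +
     \sum_(p < N.+1 | prime p && ~~ `[< fib_covers s b p >]) 1)%N.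
Proof.
move=> le_b; rewrite /primepi /good_count !big_mkcondr -big_split /=.
apply: leq_sum => p _; case: asboolP => // not_good; case: asboolP => // cov.
by case: not_good; exact: good_prime_of_covers cov.
Qed.

(** For M = floor(N^(eps/10)): eps < 1/2 gives M^20 <= N^(2 eps) <= N, and k > 10/eps gives (M +
    1)^k > N^(k eps/10) >= N. *)
Lemma powR_floor_bounds (R : realType) (eps : R) (k N : nat) :
  0 < eps -> eps < 1 / 2 -> 10 / eps < k%:R -> (0 < N)%N ->
  exists M : nat, [/\ (M ^ 10)%:R <= (N%:R : R) `^ eps,
    (M ^ 20 <= N)%N & (N < M.+1 ^ k)%N].
Proof.
move=> eps_gt0 eps_lt ltk N_gt0.
set x := (N%:R : R) `^ (eps / 10).
have x_ge0 : 0 <= x by exact: powR_ge0.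
have N_ge1 : 1 <= (N%:R : R) by rewrite ler1n.
have xE n : x ^+ n = N%:R `^ (eps / 10 * n%:R).
  by rewrite -powR_mulrn // -powRrM.
exists (Num.truncn x).
have /andP[leM ltM] := truncn_itv x_ge0.
have leMX n : (Num.truncn x ^ n)%:R <= x ^+ n by rewrite natrX lerXn2r ?nnegrE.
split.
- by apply: le_trans (leMX 10) _; rewrite xE divfK.
- rewrite -(ler_nat R); apply: le_trans (leMX 20) _.
  by rewrite xE -[leRHS]powRr1 ?ler0n //; apply: ler_powR => //; lra.
rewrite -(ltr_nat R) natrX.
have k_gt0 : (0 < k)%N by rewrite -(ltr_nat R); apply: lt_trans ltk; rewrite divr_gt0.
apply: (@le_lt_trans _ _ (x ^+ k)); last first.
  by rewrite ltrXn2r ?lt0n_neq0 //; rewrite -lt0n.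
rewrite xE -[leLHS]powRr1 ?ler0n //; apply: ler_powR => //.
by move: ltk; rewrite ltr_pdivrMr // => ?; lra.
Qed.

Unset Implicit Arguments.
Local Open Scope classical_set_scope.

Theorem theorem4 (R : realType) (eps : R) :
  0 < eps -> eps < 1 / 2 ->
  exists s : nat, (s%:R < 100 / eps) /\
    ((fun N : nat => ((good_count eps s N)%:R / (primepi N)%:R : R))
       @ \oo --> (1 : R)).
Proof.
move=> eps_gt0 eps_lt.
have q_ge0 : 0 <= 10 / eps by rewrite divr_ge0 // ltW.
pose k := (Num.truncn (10 / eps)).+1.
have /andP[lek ltk] := truncn_itv q_ge0.
(* 4k <= 40/eps + 4 < 100/eps, because 10/eps > 20. *)
exists (4 * k)%N; split.
  have : 20 < 10 / eps by rewrite ltr_pdivlMr //; lra.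
  rewrite natrM /k -addn1 natrD (_ : 100 / eps = 10 * (10 / eps)); last by ring.
  by move: lek; lra.
apply/cvgrPdist_le => e e_gt0.
have [D ltD] : exists D : nat, e^-1 < D%:R.
  by exists (Num.truncn e^-1).+1; have /andP[] := truncn_itv (ltW (eqbRL (invr_gt0 e) e_gt0)).
have [M0 few] := few_uncovered_primes_asymptotic D.+1 k.
(* (M0 + 2)^k <= N < (M + 1)^k will force M > M0; a base of at least 2 also gives N > 1. *)
exists (M0.+2 ^ k)%N => // N /= leN.
have N_gt0 : (0 < N)%N by apply: leq_trans leN; rewrite expn_gt0.
have [M [le_b leM ltM]] := powR_floor_bounds eps_gt0 eps_lt ltk N_gt0.
have leM0 : (M0 < M)%N by move: (leq_ltn_trans leN ltM); rewrite ltn_exp2r // => /ltnW.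
have := few M N (ltnW leM0) leM ltM.
have := primepi_le_good (4 * k) le_b.
set bad := (\sum_(_ < _ | _) _)%N => le_pi le_bad.
have le_good : (good_count eps (4 * k) N <= primepi N)%N.
  rewrite /good_count /primepi big_mkcondr /=; apply: leq_sum => p _; by case: ifP.
have pi_gt0 : (0 < primepi N)%N.
  have N_gt1 : (1 < N)%N.
    by apply: leq_trans leN; rewrite -(expn1 2) (leq_trans (leq_exp2l 1 k _)) ?leq_exp2r.
  (* The crude choice t = N already gives pi(N) > 0. *)
  by have := chebyshev_lower (ltn_expl N (leqnn 2)); lia.
have pi_gt0R : 0 < (primepi N)%:R :> R by rewrite ltr0n.
rewrite ger0_norm; last by rewrite subr_ge0 ler_pdivrMr // mul1r ler_nat.
rewrite -[X in X - _](divff (lt0r_neq0 pi_gt0R)) -mulrBl ler_pdivrMr //.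
rewrite -natrB //.
apply: (@le_trans _ _ (bad%:R)); first by rewrite ler_nat leq_subLR.
have : (D * bad)%:R <= (primepi N)%:R :> R by rewrite ler_nat; apply: leq_trans le_bad; lia.
rewrite natrM => le_Dbad.
rewrite -ler_pdivrMl // ; apply: le_trans le_Dbad; rewrite ler_wpM2r //; exact: ltW.
Qed.
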